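(* $\mathrm{ex}(n,K_{3,30}')=\Omega(n^{4/3})$ as $n\to\infty$; that is, there exist a constant $c>0$ and an integer $n_0$ such that $\mathrm{ex}(n,K_{3,30}')\ge c\,n^{4/3}$ for all $n\ge n_0$.
   Context: All graphs are finite, simple and undirected. For a graph $H$, the Turán number $\mathrm{ex}(n,H)$ is the maximum number of edges in an $n$-vertex graph that does not contain $H$ as a (not necessarily induced) subgraph. The 1-subdivision of $H$, denoted $H'$, is the graph obtained from $H$ by replacing the edges of $H$ by internally disjoint paths of length $2$ (i.e. each edge is subdivided by exactly one new vertex). $K_{s,t}$ is the complete bipartite graph with parts of sizes $s$ and $t$, and $K_{s,t}'$ is its 1-subdivision. *)

(* Defs.v *)
From HB Require Import structures.
From mathcomp Require Import all_boot.

Set Implicit Arguments.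
Unset Strict Implicit.
Unset Printing Implicit Defensive.

Record sgraph (V : finType) := SGraph {
  edges :> {set {set V}};
  edges_card2 : [forall e in edges, #|e| == 2]
}.

HB.instance Definition _ (V : finType) := [isSub for @edges V].
HB.instance Definition _ (V : finType) := [Finite of sgraph V by <:].

(* [f] need not reflect adjacency: the copy of [H] in [G] need not be induced. *)
Definition contains (V W : finType) (G : sgraph V) (H : sgraph W) : bool :=
  [exists f : {ffun W -> V},
     injectiveb f && [forall e in edges H, f @: e \in edges G]].

(* If every graph on [n] vertices contains [H], then the value is 0; this only
   happens for an edgeless [H] on at most [n] vertices. *)
Definition turan_number (n : nat) (W : finType) (H : sgraph W) : nat :=
  \max_(G : sgraph 'I_n | ~~ contains G H) #|edges G|.

Definition Kst_edges (s t : nat) : {set {set 'I_s + 'I_t}} :=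
  [set [set inl i; inr j] | i in 'I_s, j in 'I_t].

Lemma Kst_edges_card2 (s t : nat) : [forall e in Kst_edges s t, #|e| == 2].
Proof. by apply/forall_inP => e /imset2P[i j _ _ ->]; rewrite cards2. Qed.

Definition Kst (s t : nat) : sgraph ('I_s + 'I_t)%type :=
  SGraph (Kst_edges_card2 s t).

(* The new vertex subdividing the edge [e] is [e] itself, and it is joined to
   the two endpoints of [e]. *)
Definition subdiv_vertex (V : finType) (G : sgraph V) : finType :=
  (V + {e : {set V} | e \in edges G})%type.

Definition subdiv_edges (V : finType) (G : sgraph V) :
    {set {set subdiv_vertex G}} :=
  [set [set (inl p.1 : subdiv_vertex G); (inr p.2 : subdiv_vertex G)]
     | p : V * {e : {set V} | e \in edges G} & p.1 \in val p.2].

Lemma subdiv_edges_card2 (V : finType) (G : sgraph V) :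
  [forall e in subdiv_edges G, #|e| == 2].
Proof. by apply/forall_inP => e /imsetP[p _ ->]; rewrite cards2. Qed.

Definition subdivision (V : finType) (G : sgraph V) : sgraph (subdiv_vertex G) :=
  SGraph (subdiv_edges_card2 G).

(* Main.v *)
Require Import Defs.
From mathcomp Require Import all_boot all_order all_algebra.
From mathcomp Require Import all_fingroup all_solvable all_field.
From mathcomp Require Import ring zify.
From mathcomp Require Import reals exp.

(** Let F be a field with q = 3^(k+1) elements and S a subset of F with q/3
    elements such that no four elements of S, repetitions allowed, sum to 0: a
    coset of an additive subgroup of index 3 that does not contain 0.  Join two
    points (a, b, c) and (a', b', c') of S x F x F when

      b + c' = a a'^2   and   c + b' = a^2 a'.

    This relation is symmetric, and a point has exactly one neighbour with each
    prescribed first coordinate in S.  So there are q^3 vertices and about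
    q^4/18 edges, which is the order n^(4/3).

    In a copy of the subdivision of K_{3,t}, let x_0, x_1, x_2 be the three
    branch vertices and z any of the other t.  If x_i = (a_i, b_i, c_i) and
    z = (p, q, r) have a common neighbour with first coordinate t, then

      q - b_i = t^2 (p - a_i)   and   r - c_i = t (p^2 - a_i^2),

    whence (r - c_i)^2 = (q - b_i) Phi_i(p), with Phi_i = (X - a_i)(X + a_i)^2.
    For fixed p these are three parabolas in the plane of (q, r), and the
    difference of two of them is linear in (q, r).  Eliminating q and r leaves a
    polynomial of degree at most 10 in p alone ([resL]); over each of its roots
    there are at most two points z.  So at most 20 points z exist, provided that
    the polynomial is not zero.

    The polynomial does vanish identically when x_1 and x_2 are related to x_0
    by the two equations above with one and the same t, for instance when the
    three x_i have a common neighbour.  There is no other such case ([resL_eq0],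
    read off from five of the coefficients), and in this case the paths from z
    to x_0 and to x_1, which have different middle vertices, give another
    equation, of degree 3 in p ([card_Z_line]).  The elimination needs a_1 and
    a_2 different from a_0; up to the order of the x_i, this fails only if the
    three a_i are equal, and then the equations are simpler ([card_Z_equal]).

    The condition on S excludes the remaining dense families.  It makes p + a_i
    nonzero, so that no Phi_i(p) is zero, and it makes p + a_0 + a_1 + a_2
    nonzero.  The last sum vanishes when p takes the same value under three
    different Phi_i; without this condition, three points that agree in
    b and c would have a whole parabola of points z in common over such a p. *)

Set Implicit Arguments.
Unset Strict Implicit.
Unset Printing Implicit Defensive.
Import Order.TTheory GRing.Theory Num.Theory.

(** * Counting fibres *)

Lemma leq_card_fibers (T T' : finType) (f : T -> T') (A : {set T}) n :
    (forall y, y \in f @: A -> #|[set x in A | f x == y]| <= n)%N ->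
  (#|A| <= n * #|f @: A|)%N.
Proof.
move=> fib; rewrite -sum1_card (partition_big f (mem (f @: A))) /=; last first.
  by move=> x; apply: imset_f.
rewrite mulnC -sum_nat_const; apply: leq_sum => y yA.
by rewrite sum1dep_card; apply: fib.
Qed.

(** * Copies of subdivided complete bipartite graphs *)

Lemma Kst_edgeP s t (i : 'I_s) (j : 'I_t) :
  [set inl i; inr j] \in edges (Kst s t).
Proof. exact: imset2_f. Qed.

Definition Kst_edge s t (i : 'I_s) (j : 'I_t) :
    {e : {set 'I_s + 'I_t} | e \in edges (Kst s t)} :=
  exist (fun e => e \in edges (Kst s t)) _ (Kst_edgeP i j).

Lemma subdivision_covered s t (w : subdiv_vertex (Kst s t)) : 0 < s -> 0 < t ->
  exists2 e, e \in edges (subdivision (Kst s t)) & w \in e.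
Proof.
move=> s0 t0.
case: w => [v|e].
  have [e ve] : exists e : {e : {set 'I_s + 'I_t} | e \in edges (Kst s t)},
      v \in val e.
    case: v => [i|j].
      by exists (Kst_edge i (Ordinal t0)); rewrite /= !inE eqxx.
    by exists (Kst_edge (Ordinal s0) j); rewrite /= !inE eqxx orbT.
  exists [set inl v; inr e]; last by rewrite !inE eqxx.
  by apply/imsetP; exists (v, e); rewrite ?inE.
have [v ve] : exists v, v \in val e.
  apply/card_gt0P; case: e => e /= eE.
  by have /forall_inP/(_ e eE)/eqP-> := edges_card2 (Kst s t).
exists [set inl v; inr e]; last by rewrite !inE eqxx orbT.
by apply/imsetP; exists (v, e); rewrite ?inE.
Qed.

(** A graph on at most [n] vertices can be padded with isolated vertices.  The
    padding cannot receive a vertex of a copy of [H], because each vertex of [H]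
    lies on an edge. *)
Lemma leq_turan_number (V W : finType) (G : sgraph V) (H : sgraph W) n :
    (#|V| <= n)%N -> (forall w, exists2 e, e \in edges H & w \in e) ->
    ~~ contains G H ->
  (#|edges G| <= turan_number n H)%N.
Proof.
move=> Vn Hcov GH.
pose h (v : V) : 'I_n := widen_ord Vn (enum_rank v).
have hI : injective h by move=> u v /(congr1 val) /= /ord_inj /enum_rank_inj.
pose E := [set h @: (e : {set V}) | e in edges G].
have E2 : [forall e in E, #|e| == 2].
  apply/forall_inP => _ /imsetP[e eG ->]; rewrite card_imset //.
  by have /forall_inP := edges_card2 G; apply.
have -> : #|edges G| = #|edges (SGraph E2)|.
  by rewrite card_imset //; apply: imset_inj.
apply: (leq_bigmax_cond (SGraph E2)).
apply: contra GH => /existsP[f /andP[/injectiveP fI /forall_inP fE]].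
have f_h w : exists v, h v == f w.
  have [e eH we] := Hcov w; have /imsetP[e' _ fe] := fE e eH.
  have : f w \in h @: e' by rewrite -fe imset_f.
  by case/imsetP => v _ ->; exists v.
pose g := [ffun w => xchoose (f_h w)].
have gK w : h (g w) = f w.
  by rewrite ffunE; apply/eqP; apply: (xchooseP (f_h w)).
apply/existsP; exists g; apply/andP; split.
  by apply/injectiveP => u v guv; apply: fI; rewrite -!gK guv.
apply/forall_inP => e eH; have /imsetP[e' eG fe] := fE e eH.
suff -> : g @: e = e' by [].
apply: (imset_inj hI); rewrite -fe -imset_comp.
by apply: eq_imset => w /=; rewrite gK.
Qed.

(** The middle vertices [y i j] of the paths that end in one [z j] are distinct:
    this is what excludes that a single vertex joins [z j] to several [x i]. *)
Lemma contains_subdivision_Kst (V : finType) (G : sgraph V) s t :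
    contains G (subdivision (Kst s t)) ->
  exists (x : 'I_s -> V) (y : 'I_s -> 'I_t -> V) (z : 'I_t -> V),
    [/\ injective x, injective z, (forall i j, z j != x i),
        (forall j, injective (y ^~ j)) &
        forall i j, [set x i; y i j] \in edges G
                    /\ [set z j; y i j] \in edges G].
Proof.
case/existsP=> f /andP[/injectiveP fI /forall_inP fE].
pose e := @Kst_edge s t.
have adj v i j : v \in val (e i j) ->
    [set f (inl v); f (inr (e i j))] \in edges G.
  move=> ve; have <- : f @: [set inl v; inr (e i j)]
                       = [set f (inl v); f (inr (e i j))].
    by rewrite imsetU1 imset_set1.
  apply: fE; apply/imsetP; exists (v, e i j) => //.
  by rewrite in_set; exact: ve.
exists (fun i => f (inl (inl i))), (fun i j => f (inr (e i j))),
  (fun j => f (inl (inr j))).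
split=> [i i' /fI[] // | j j' /fI[] // | i j | j i i' /fI[ee] | i j].
- by apply/eqP => /fI.
- have : inl i \in [set inl i'; inr j] by rewrite -ee !inE eqxx.
  by rewrite !inE orbF => /eqP[].
- by split; apply: adj; rewrite /= !inE eqxx ?orbT.
Qed.

Local Open Scope ring_scope.

(** * Polynomial arithmetic on coefficient lists *)

Section CoefLists.
Variable F : fieldType.
Implicit Types (c x : F) (s t : seq F).

(** Coefficient lists, constant term first, stand for polynomials whose
    coefficients have to be computed: on concrete lists these operations reduce,
    so that each coefficient becomes a ring expression. *)
Fixpoint addL s t : seq F :=
  match s, t with
  | x :: s', y :: t' => x + y :: addL s' t'
  | [::], _ => t
  | _, [::] => s
  end.
Definition scaleL c s := [seq c * x | x <- s].
Definition subL s t := addL s (scaleL (-1) t).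
Fixpoint mulL s t : seq F :=
  if s is x :: s' then addL (scaleL x t) (0 :: mulL s' t) else [::].

Lemma Poly_addL s t : Poly (addL s t) = Poly s + Poly t.
Proof.
elim: s t => [|x s IH] [|y t]; rewrite /= ?add0r ?addr0 //.
by rewrite IH !cons_poly_def polyCD; ring.
Qed.

Lemma Poly_scaleL c s : Poly (scaleL c s) = c *: Poly s.
Proof.
elim: s => [|x s IH]; rewrite /= ?scaler0 // IH !cons_poly_def -!mul_polyC.
by rewrite polyCM; ring.
Qed.

Lemma Poly_subL s t : Poly (subL s t) = Poly s - Poly t.
Proof. by rewrite Poly_addL Poly_scaleL scaleN1r. Qed.

Lemma Poly_mulL s t : Poly (mulL s t) = Poly s * Poly t.
Proof.
elim: s => [|x s IH]; first by rewrite mul0r.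
rewrite [LHS]Poly_addL Poly_scaleL /= !cons_poly_def addr0 IH -mul_polyC.
by ring.
Qed.

Definition Poly_opE := (Poly_subL, Poly_addL, Poly_scaleL, Poly_mulL).

Lemma coef_Poly_eq0 s k : Poly s = 0 -> s`_k = 0.
Proof. by move=> s0; rewrite -coef_Poly s0 coef0. Qed.

End CoefLists.

(** * Eliminating two coordinates from three quadrics *)

Section Resultant.
Variable F : fieldType.
Implicit Types a b c p q r t : F.

Definition Phi a p := (p - a) * (p + a) ^+ 2.

(** The coefficients of [Phi a], of [Phi a - Phi a0], where the cubic terms
    cancel, and of [c ^+ 2 + b * Phi a], in this order. *)
Definition PhiL a : seq F := [:: - a ^+ 3; - a ^+ 2; a; 1].
Definition slopeL a0 a : seq F :=
  [:: a0 ^+ 3 - a ^+ 3; a0 ^+ 2 - a ^+ 2; a - a0].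
Definition constL a b c : seq F :=
   [:: c ^+ 2 - b * a ^+ 3; - (b * a ^+ 2); b * a; b].

Lemma horner_PhiL a p : (Poly (PhiL a)).[p] = Phi a p.
Proof. by rewrite horner_Poly /Phi /=; ring. Qed.

Lemma horner_slopeL a0 a p : (Poly (slopeL a0 a)).[p] = Phi a p - Phi a0 p.
Proof. by rewrite horner_Poly /Phi /=; ring. Qed.

Lemma horner_constL a b c p : (Poly (constL a b c)).[p] = c ^+ 2 + b * Phi a p.
Proof. by rewrite horner_Poly /Phi /=; ring. Qed.

(** By Cramer's rule, the two equations
    (Phi_i - Phi_0) q + 2 c_i r = c_i^2 + b_i Phi_i, for i = 1, 2, have solution
    q = Nq / D and r = Nr / (2 D); the list is Nr^2 - 4 D Nq Phi_0, which
    vanishes where r^2 = q Phi_0. *)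
Definition resL a0 a1 b1 c1 a2 b2 c2 : seq F :=
  let Nr := subL (mulL (slopeL a0 a1) (constL a2 b2 c2))
                 (mulL (slopeL a0 a2) (constL a1 b1 c1)) in
  let D := subL (scaleL c2 (slopeL a0 a1)) (scaleL c1 (slopeL a0 a2)) in
  let Nq := subL (scaleL c2 (constL a1 b1 c1)) (scaleL c1 (constL a2 b2 c2)) in
  subL (mulL Nr Nr) (scaleL 4%:R (mulL (mulL D Nq) (PhiL a0))).

Lemma root_resL a0 a1 b1 c1 a2 b2 c2 p q r :
    r ^+ 2 = q * Phi a0 p ->
    (Phi a1 p - Phi a0 p) * q + 2%:R * c1 * r = c1 ^+ 2 + b1 * Phi a1 p ->
    (Phi a2 p - Phi a0 p) * q + 2%:R * c2 * r = c2 ^+ 2 + b2 * Phi a2 p ->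
  root (Poly (resL a0 a1 b1 c1 a2 b2 c2)) p.
Proof.
move=> r2 l1 l2; apply/eqP.
rewrite /resL !Poly_opE !(hornerD, hornerN, hornerM, hornerZ).
rewrite !(horner_PhiL, horner_slopeL, horner_constL) -l1 -l2.
move: (Phi a1 p) (Phi a2 p) => f1 f2 in l1 l2 *.
move: (Phi a0 p) => f0 in r2 l1 l2 *.
transitivity (4%:R * ((f1 - f0) * c2 - (f2 - f0) * c1) ^+ 2
              * (r ^+ 2 - q * f0)); first by ring.
by rewrite r2 subrr mulr0.
Qed.

(** If the polynomial is zero, its coefficients of degree 10, 8, 6, 5 and 4
    determine [b1], [c1], [b2] and [c2] in turn: each of the following formulas
    uses the shape that the vanishing of the preceding ones forces. *)
Lemma resL_coef10 a0 a1 b1 c1 a2 b2 c2 :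
  (resL a0 a1 b1 c1 a2 b2 c2)`_10 = ((a1 - a0) * b2 - (a2 - a0) * b1) ^+ 2.
Proof. by rewrite /=; ring. Qed.

Lemma resL_coef8 a0 a1 k1 a2 k2 m :
  (resL a0 a1 (m * (a1 - a0)) (k1 * (a1 - a0))
        a2 (m * (a2 - a0)) (k2 * (a2 - a0)))`_8
  = (2%:R * (a1 - a0) * (a2 - a0)) ^+ 2
    * (m * (m * (a2 - a1) ^+ 2 - (k2 - k1) ^+ 2)).
Proof. by rewrite /=; ring. Qed.

Lemma resL_coef6 a0 a1 a2 t k :
  (resL a0 a1 (t ^+ 2 * (a1 - a0)) ((t * a1 + k) * (a1 - a0))
        a2 (t ^+ 2 * (a2 - a0)) ((t * a2 + k) * (a2 - a0)))`_6
  = 2%:R * (2%:R * (a1 - a0) * (a2 - a0) * t * (a2 - a1) * (k - t * a0)) ^+ 2.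
Proof. by rewrite /=; ring. Qed.

Lemma resL_coef5 a0 a1 k1 a2 k2 :
  (resL a0 a1 0 (k1 * (a1 - a0)) a2 0 (k2 * (a2 - a0)))`_5
  = - (2%:R * (a1 - a0) * (a2 - a0)) ^+ 2
    * (k1 * k2 * ((a1 - a0) * k1 - (a2 - a0) * k2) * (k2 - k1)).
Proof. by rewrite /=; ring. Qed.

Lemma resL_coef4 a0 a1 k1 a2 k2 (d1 := a1 - a0) (d2 := a2 - a0) :
    k1 * k2 * (d1 * k1 - d2 * k2) = 0 ->
  (resL a0 a1 0 (k1 * d1) a2 0 (k2 * d2))`_4
  = (d1 * d2 * (d2 * k2 ^+ 2 - d1 * k1 ^+ 2)) ^+ 2.
Proof.
move=> w0; rewrite /= -/d1 -/d2.
transitivity ((d1 * d2 * (d2 * k2 ^+ 2 - d1 * k1 ^+ 2)) ^+ 2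
  - (2%:R * d1 * d2) ^+ 2 * (k1 * k2 * (d1 * k1 - d2 * k2)) *
    (a0 * (k2 - k1) - (k2 * (a1 + a0) - k1 * (a2 + a0)))).
  by rewrite /d1 /d2; ring.
by rewrite w0; ring.
Qed.

Lemma resL_coef4_diag a0 a1 a2 k :
  (resL a0 a1 0 (k * (a1 - a0)) a2 0 (k * (a2 - a0)))`_4
  = 5%:R * ((a1 - a0) * (a2 - a0) * (a2 - a1) * k ^+ 2) ^+ 2.
Proof. by rewrite /=; ring. Qed.

Hypotheses (two_neq0 : 2%:R != 0 :> F) (five_neq0 : 5%:R != 0 :> F).

(** Write d_i = a_i - a_0.  Degree 10 gives b_i = m d_i, and c_i = d_i k_i
    defines k_i.  In degree 8, either m = 0 or m is the square of the slope t of
    k as a function of a; in the second case degree 6 fixes the constant term of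
    k.  If m = 0, degrees 5 and 4 leave only k_1 = k_2 = 0, which is t = 0. *)
Lemma resL_eq0 a0 a1 b1 c1 a2 b2 c2 :
    a1 != a0 -> a2 != a0 -> (a1, b1, c1) != (a2, b2, c2) ->
    Poly (resL a0 a1 b1 c1 a2 b2 c2) = 0 ->
  exists t, [/\ b1 = t ^+ 2 * (a1 - a0), c1 = t * (a1 ^+ 2 - a0 ^+ 2),
                b2 = t ^+ 2 * (a2 - a0) & c2 = t * (a2 ^+ 2 - a0 ^+ 2)].
Proof.
rewrite -(subr_eq0 a1) -(subr_eq0 a2) => d1 d2 x12 R0.
pose m := b1 / (a1 - a0); pose k1 := c1 / (a1 - a0); pose k2 := c2 / (a2 - a0).
have b1E : b1 = m * (a1 - a0) by rewrite mulfVK.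
have c1E : c1 = k1 * (a1 - a0) by rewrite mulfVK.
have c2E : c2 = k2 * (a2 - a0) by rewrite mulfVK.
have b2E : b2 = m * (a2 - a0).
  have /eqP := coef_Poly_eq0 10 R0.
  rewrite resL_coef10 expf_eq0 /= subr_eq0 => /eqP e.
  by apply: (mulfI d1); rewrite e b1E; ring.
clearbody m k1 k2; subst b1 c1 b2 c2.
have x12' : (a1 == a2) && (k1 == k2) = false.
  by apply: contraNF x12 => /andP[/eqP e1 /eqP e2]; rewrite e1 e2.
have dd0 : (2%:R * (a1 - a0) * (a2 - a0)) ^+ 2 != 0.
  by rewrite expf_neq0 // !mulf_neq0.
have := coef_Poly_eq0 8 R0; rewrite resL_coef8 => /eqP.
rewrite mulf_eq0 (negPf dd0) /= mulf_eq0.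
have [m0 _|m0 /=] := eqVneq m 0.
  exists 0; suff [-> ->] : k1 = 0 /\ k2 = 0 by rewrite m0; split; ring.
  rewrite {}m0 !mul0r in R0.
  have /eqP := coef_Poly_eq0 5 R0; rewrite resL_coef5.
  set w := k1 * k2 * _.
  rewrite mulf_eq0 oppr_eq0 (negPf dd0) /= mulf_eq0.
  have [w0 _|w0 /=] := eqVneq w 0.
    have /eqP := coef_Poly_eq0 4 R0; rewrite resL_coef4 // expf_eq0 /=.
    rewrite !mulf_eq0 (negPf d1) (negPf d2) /= => /eqP e.
    move/eqP: w0; rewrite /w !mulf_eq0 -orbA => /or3P[] /eqP z.
    - split=> //; move: e; rewrite z expr0n /= mulr0 subr0 => /eqP.
      by rewrite mulf_eq0 (negPf d2) expf_eq0 /= => /eqP.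
    - split=> //; move: e; rewrite z expr0n /= mulr0 sub0r => /eqP.
      by rewrite oppr_eq0 mulf_eq0 (negPf d1) expf_eq0 /= => /eqP.
    have : (a2 - a0) * k2 * (k2 - k1) = 0.
      rewrite -e; transitivity ((a2 - a0) * k2 ^+ 2 - (a1 - a0) * k1 * k1
        + ((a1 - a0) * k1 - (a2 - a0) * k2) * k1); first by ring.
      by rewrite z; ring.
    move/eqP; rewrite !mulf_eq0 (negPf d2) /= => /orP[/eqP k20|].
      split=> //; move/eqP: z; rewrite k20 mulr0 subr0 mulf_eq0 (negPf d1) /=.
      by move/eqP.
    rewrite subr_eq0 => /eqP k21; subst k2.
    move: z; rewrite -mulrBl => /eqP; rewrite mulf_eq0 => /orP[|/eqP//].
    have -> : a1 - a0 - (a2 - a0) = a1 - a2 by ring.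
    by rewrite subr_eq0 => a12; rewrite a12 eqxx in x12'.
  rewrite subr_eq0 => /eqP k21; clear w w0; subst k2.
  have /eqP := coef_Poly_eq0 4 R0; rewrite resL_coef4_diag.
  rewrite mulf_eq0 (negPf five_neq0) expf_eq0 /= mulf_eq0 mulf_eq0.
  rewrite mulf_eq0 (negPf d1) (negPf d2) subr_eq0 expf_eq0 /=.
  case/orP=> [/eqP a21|/eqP->//].
  by rewrite a21 !eqxx in x12'.
rewrite subr_eq0 => /eqP me.
have e0 : a2 - a1 != 0.
  apply/negP => /eqP e; move/negP: x12'; apply.
  move/eqP: me; rewrite e expr0n /= mulr0 eq_sym expf_eq0 /= subr_eq0 => /eqP->.
  by rewrite eq_sym -subr_eq0 e !eqxx.
pose t := (k2 - k1) / (a2 - a1); pose k := k1 - t * a1.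
have mE : m = t ^+ 2.
  by apply: (mulIf (expf_neq0 2 e0)); rewrite me -exprMn mulfVK.
have k1E : k1 = t * a1 + k by rewrite /k; ring.
have k2E : k2 = t * a2 + k.
  have -> : k2 = k1 + t * (a2 - a1) by rewrite mulfVK //; ring.
  by rewrite /k; ring.
have t0 : t != 0 by apply: contraNneq m0 => t0; rewrite mE t0 expr0n.
clearbody t k; subst m k1 k2.
have /eqP := coef_Poly_eq0 6 R0; rewrite resL_coef6.
rewrite mulf_eq0 expf_eq0 /= !mulf_eq0.
rewrite (negPf two_neq0) (negPf d1) (negPf d2) (negPf t0) (negPf e0) /=.
by rewrite subr_eq0 => /eqP ->; exists t; split=> //; ring.
Qed.
End Resultant.

(** * Points at distance two from three given points *)

Section Counting.
Variable F : finFieldType.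

Lemma leq_card_roots (p : {poly F}) (A : {set F}) n :
  p != 0 -> (size p <= n.+1)%N -> {in A, forall x, root p x} -> (#|A| <= n)%N.
Proof.
move=> p0 sp rA; rewrite -ltnS; apply: leq_trans sp; rewrite cardE.
apply: max_poly_roots p0 _ (enum_uniq _).
by apply/allP => x; rewrite mem_enum => /rA.
Qed.

(** The form in which an elimination bounds a set of points: [f] takes few
    values because they are roots of [P], and over each value of [f] there are
    few points because [g] is a root of a polynomial given by this value. *)
Lemma leq_card_two_roots (T : finType) (f g : T -> F) (A : {set T})
    (P : {poly F}) (G : F -> {poly F}) m n :
    {in A &, injective (fun z => (f z, g z))} ->
    P != 0 -> (size P <= m.+1)%N -> {in A, forall z, root P (f z)} ->
    {in A, forall z, [/\ G (f z) != 0, (size (G (f z)) <= n.+1)%N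
                       & root (G (f z)) (g z)]} ->
  (#|A| <= n * m)%N.
Proof.
move=> inj P0 sP rP rG.
apply: leq_trans (leq_card_fibers (f := f) (n := n) _) _.
  move=> _ /imsetP[z zA ->]; have [G0 sG _] := rG z zA.
  rewrite -(card_in_imset (f := g)); last first.
    move=> u v; rewrite !inE => /andP[uA /eqP fu] /andP[vA /eqP fv] guv.
    by apply: inj; rewrite // fu fv guv.
  apply: (leq_card_roots G0 sG) => _ /imsetP[u + ->]; rewrite inE.
  by case/andP=> uA /eqP <-; have [] := rG u uA.
rewrite leq_mul2l (leq_card_roots P0 sP) ?orbT //.
by move=> _ /imsetP[z zA ->]; apply: rP.
Qed.

(** The relation between two points that share a neighbour whose first
    coordinate is [t]. *)
Definition link (x z : F * F * F) t :=
  z.1.2 - x.1.2 = t ^+ 2 * (z.1.1 - x.1.1) /\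
  z.2 - x.2 = t * (z.1.1 ^+ 2 - x.1.1 ^+ 2).

Lemma link_neq x z t : link x z t -> z != x -> z.1.1 != x.1.1.
Proof.
case: x z => [[a b] c] [[p q] r] [/= e1 e2]; apply: contraNneq => pa.
move: e1 e2; rewrite pa !subrr !mulr0 => /eqP + /eqP.
by rewrite !subr_eq0 => /eqP-> /eqP->.
Qed.

Lemma link_quadric x z t : link x z t ->
  (z.2 - x.2) ^+ 2 = (z.1.2 - x.1.2) * Phi x.1.1 z.1.1.
Proof. by case=> -> ->; rewrite /Phi; ring. Qed.

Lemma quadric_diff (a0 a b c p q r : F) :
    r ^+ 2 = q * Phi a0 p -> (r - c) ^+ 2 = (q - b) * Phi a p ->
  (Phi a p - Phi a0 p) * q + 2%:R * c * r = c ^+ 2 + b * Phi a p.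
Proof.
move=> e0 e; apply/eqP; rewrite -subr_eq0; apply/eqP.
transitivity ((r ^+ 2 - q * Phi a0 p) - ((r - c) ^+ 2 - (q - b) * Phi a p)).
  by ring.
by rewrite e0 e !subrr.
Qed.

Variable S : {set F}.
Hypothesis S4 : {in S & &, forall a b c, {in S, forall d, a + b + c + d != 0}}.
Hypothesis five_neq0 : 5%:R != 0 :> F.

Lemma addS_neq0 : {in S &, forall a b, a + b != 0}.
Proof.
move=> a b aS bS; apply: contra_neq (S4 aS aS bS bS) => ab.
by transitivity ((a + b) + (a + b)); [ring | rewrite ab addr0].
Qed.

Lemma two_neq0 a : a \in S -> 2%:R != 0 :> F.
Proof.
move=> aS; apply: contra_neq (addS_neq0 aS aS) => e.
by transitivity (2%:R * a); [ring | rewrite e mul0r].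
Qed.

Lemma Phi_neq0 a p : a \in S -> p \in S -> p != a -> Phi a p != 0.
Proof.
by move=> aS pS pa; rewrite mulf_neq0 ?subr_eq0 // expf_neq0 // addS_neq0.
Qed.

Lemma link_inj x z t u : x.1.1 \in S -> z.1.1 \in S -> z != x ->
  link x z t -> link x z u -> t = u.
Proof.
move=> xS zS zx lt lu; have pa := link_neq lt zx.
case: lt lu => _ e [_]; rewrite e; apply: mulIf.
by rewrite subr_sqr mulf_neq0 ?subr_eq0 // addS_neq0.
Qed.

(** The difference quotients (Phi_i - Phi_0) / (a_i - a_0), for i = 1, 2, differ
    by (a_1 - a_2) (p + a_0 + a_1 + a_2). *)
Lemma Phi_diff_eq a0 a1 a2 p : a0 \in S -> a1 \in S -> a2 \in S -> p \in S ->
  a1 != a0 -> a2 != a0 ->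
  Phi a1 p = Phi a0 p -> Phi a2 p = Phi a0 p -> a1 = a2.
Proof.
move=> S0 S1 S2 Sp; rewrite -(subr_eq0 a1) -(subr_eq0 a2) => d1 d2 e1 e2.
apply/eqP; rewrite -subr_eq0.
have s0 : a0 + a1 + a2 + p != 0 by apply: S4.
apply/eqP; apply: (mulIf s0); apply: (mulfI d1); apply: (mulfI d2).
transitivity ((a1 - a0) * (Phi a2 p - Phi a0 p)
              - (a2 - a0) * (Phi a1 p - Phi a0 p)); first by rewrite /Phi; ring.
by rewrite e1 e2 !subrr; ring.
Qed.


Section Base.
Variables (x0 x1 x2 : F * F * F) (Z : {set F * F * F}).
(* The second and third coordinates enter the equations through differences
   only, so that x0 may be moved to (a0, 0, 0). *)
Let a0 := x0.1.1. Let a1 := x1.1.1. Let a2 := x2.1.1.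
Let b1 := x1.1.2 - x0.1.2. Let b2 := x2.1.2 - x0.1.2.
Let c1 := x1.2 - x0.2. Let c2 := x2.2 - x0.2.
Hypotheses (S0 : a0 \in S) (S1 : a1 \in S) (S2 : a2 \in S).
Hypothesis neq12 : x1 != x2.
Hypothesis ZS : {in Z, forall z, z.1.1 \in S}.
Hypothesis ZN : {in Z, forall z, [/\ z != x0, z != x1 & z != x2]}.
Hypothesis Zlink : {in Z, forall z, exists t0 t1 t2 : F,
  [/\ link x0 z t0, link x1 z t1, link x2 z t2 & t0 != t1]}.

Let bc12 : a1 = a2 -> b1 = b2 -> c1 = c2 -> False.
Proof.
move=> ea /addIr eb /addIr ec; case/eqP: neq12.
move: ea eb ec; rewrite /a1 /a2.
by case: x1 x2 => [[? ?] ?] [[? ?] ?] /= -> -> ->.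
Qed.

Lemma Z_quadrics z (p := z.1.1) (q := z.1.2 - x0.1.2) (r := z.2 - x0.2) :
  z \in Z ->
  [/\ p \in S,
      [/\ Phi a0 p != 0, Phi a1 p != 0 & Phi a2 p != 0],
      r ^+ 2 = q * Phi a0 p,
      (Phi a1 p - Phi a0 p) * q + 2%:R * c1 * r = c1 ^+ 2 + b1 * Phi a1 p &
      (Phi a2 p - Phi a0 p) * q + 2%:R * c2 * r = c2 ^+ 2 + b2 * Phi a2 p].
Proof.
move=> zZ; have [t0 [t1 [t2 [l0 l1 l2 _]]]] := Zlink zZ.
have [n0 n1 n2] := ZN zZ; have Sp := ZS zZ.
have e0 : r ^+ 2 = q * Phi a0 p := link_quadric l0.
split=> //.
- split; apply: Phi_neq0 => //.
  + exact: link_neq l0 n0.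
  + exact: link_neq l1 n1.
  + exact: link_neq l2 n2.
- apply: quadric_diff e0 _; rewrite /r /c1 /q /b1 !opprB !addrA !subrK.
  exact: (link_quadric l1).
- apply: quadric_diff e0 _; rewrite /r /c2 /q /b2 !opprB !addrA !subrK.
  exact: (link_quadric l2).
Qed.

(** The second coordinate is determined by the others through r^2 = q Phi_0. *)
Lemma Z_inj : {in Z &, injective (fun z => (z.1.1, z.2 - x0.2))}.
Proof.
move=> u v uZ vZ [ep /addIr er].
have [_ [n0 _ _] eu _ _] := Z_quadrics uZ; have [_ _ ev _ _] := Z_quadrics vZ.
move: eu ev; rewrite er ep => -> /(mulIf _) /addIr; rewrite -ep => /(_ n0) eq.
move: ep er eq; case: u {uZ n0} => [[? ?] ?].
by case: v {vZ} => [[? ?] ?] /= -> -> ->.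
Qed.

Lemma card_Z_generic : a1 != a0 -> a2 != a0 ->
  Poly (resL a0 a1 b1 c1 a2 b2 c2) != 0 -> (#|Z| <= 20)%N.
Proof.
move=> d1 d2 R0.
(* Over a fixed p, the line i meets the parabola r^2 = q Phi_0 where r is a root
   of a quadratic polynomial, which is zero only if Phi_i = Phi_0 at p and
   b_i = c_i = 0.  This does not happen for both lines, by [Phi_diff_eq]. *)
pose quad a b c p : seq F :=
  [:: - (c ^+ 2 + b * Phi a p) * Phi a0 p; 2%:R * c * Phi a0 p;
      Phi a p - Phi a0 p].
pose G p := let G1 := Poly (quad a1 b1 c1 p) in
            if G1 == 0 then Poly (quad a2 b2 c2 p) else G1.
apply: (leq_card_two_roots (m := 10) (n := 2) (G := G) Z_inj R0).
- exact: size_Poly.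
- by move=> z /Z_quadrics[_ _ e0 e1 e2]; apply: root_resL e0 e1 e2.
move=> z zZ; have [Sp [f0 f1 f2] e0 e1 e2] := Z_quadrics zZ.
move: (z.1.1) (z.1.2 - _) (z.2 - _) Sp f0 f1 f2 e0 e1 e2.
move=> p q r Sp f0 f1 f2 e0 e1 e2.
have root_quad a b c : 
    (Phi a p - Phi a0 p) * q + 2%:R * c * r = c ^+ 2 + b * Phi a p ->
  root (Poly (quad a b c p)) r.
  move=> e; apply/rootP; rewrite horner_Poly /= -e.
  transitivity ((Phi a p - Phi a0 p) * (r ^+ 2 - q * Phi a0 p)); first by ring.
  by rewrite e0 subrr mulr0.
have quad_eq0 a b c : Phi a p != 0 ->
    (Phi a p - Phi a0 p) * q + 2%:R * c * r = c ^+ 2 + b * Phi a p ->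
    Poly (quad a b c p) = 0 -> [/\ Phi a p = Phi a0 p, b = 0 & c = 0].
  move=> f e z0.
  have /eqP ea := coef_Poly_eq0 2 z0; rewrite /= subr_eq0 in ea.
  have /eqP ec := coef_Poly_eq0 1 z0.
  rewrite /= mulf_eq0 (negPf f0) orbF mulf_eq0 (negPf (two_neq0 S0)) /= in ec.
  move: e; rewrite (eqP ea) (eqP ec) subrr !mulr0 !mul0r expr0n !add0r.
  move=> /esym/eqP; rewrite mulf_eq0 (negPf f0) orbF => /eqP->.
  by split=> //; apply/eqP.
rewrite /G; have [G1|G1] := eqVneq (Poly (quad a1 b1 c1 p)) 0; last first.
  by split; [exact: G1 | exact: size_Poly | exact: root_quad].
split; [| exact: size_Poly | exact: root_quad].
apply/eqP => G2.
have [p1 z1 w1] := quad_eq0 _ _ _ f1 e1 G1.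
have [p2 z2 w2] := quad_eq0 _ _ _ f2 e2 G2.
by apply: bc12; rewrite ?z1 ?w1 //; apply: Phi_diff_eq p1 p2.
Qed.

(** The hypotheses say that x_0 is linked to x_1 and to x_2 with the same [t].
    If x_0 is linked to z with u, then, for i = 1 and i = 2, u is a root of a
    quadratic equation that has t as a root too.  The neighbour shared by z and x_0 differs from the one shared
    by z and x_1, so u is the other root, which gives u B_i = - t C_i.  The
    polynomial B_1 C_2 - B_2 C_1 is cubic with leading coefficient
    2 (a_2 - a_1). *)
Lemma card_Z_line t : a1 != a0 -> a2 != a0 ->
    b1 = t ^+ 2 * (a1 - a0) -> c1 = t * (a1 ^+ 2 - a0 ^+ 2) ->
    b2 = t ^+ 2 * (a2 - a0) -> c2 = t * (a2 ^+ 2 - a0 ^+ 2) ->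
  (#|Z| <= 20)%N.
Proof.
move=> d1 d2 eb1 ec1 eb2 ec2.
have a12 : a2 - a1 != 0.
  apply/negP; rewrite subr_eq0 => /eqP e; apply: bc12; rewrite ?e //.
    by rewrite eb1 eb2 e.
  by rewrite ec1 ec2 e.
pose B a p := p ^+ 2 - (a + a0) * p - (a ^+ 2 + a * a0 + a0 ^+ 2).
pose C a p := p ^+ 2 + (a + a0) * p + a0 ^+ 2 + a * a0 - a ^+ 2.
have slope z : z \in Z -> exists u, [/\ u != t,
    z.2 - x0.2 = u * (z.1.1 ^+ 2 - a0 ^+ 2),
    u * B a1 z.1.1 = - t * C a1 z.1.1 & u * B a2 z.1.1 = - t * C a2 z.1.1].
  move=> zZ; have [u [t1 [t2 [l0 l1 l2 ut1]]]] := Zlink zZ.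
  have [n0 n1 n2] := ZN zZ; have [Sp _ _ e1 e2] := Z_quadrics zZ.
  have ut : u != t.
    apply: contraNneq ut1 => ut; subst u; apply/eqP.
    apply: (link_inj S1 Sp n1 _ l1); case: l0 => q0 r0; split.
      transitivity (z.1.2 - x0.1.2 - b1); first by rewrite /b1; ring.
      by rewrite q0 eb1 /a1 /a0; ring.
    transitivity (z.2 - x0.2 - c1); first by rewrite /c1; ring.
    by rewrite r0 ec1 /a1 /a0; ring.
  have pa0 : z.1.1 - a0 != 0 by rewrite subr_eq0 (link_neq l0).
  case: l0 => q0 r0; rewrite -/a0 in q0 r0; rewrite q0 r0 in e1 e2.
  have second a b c : a != a0 ->
      b = t ^+ 2 * (a - a0) -> c = t * (a ^+ 2 - a0 ^+ 2) ->
      (Phi a z.1.1 - Phi a0 z.1.1) * (u ^+ 2 * (z.1.1 - a0))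
        + 2%:R * c * (u * (z.1.1 ^+ 2 - a0 ^+ 2)) = c ^+ 2 + b * Phi a z.1.1 ->
    u * B a z.1.1 = - t * C a z.1.1.
    rewrite -(subr_eq0 a) -(subr_eq0 u) in ut * => d -> -> e.
    apply/eqP; rewrite -subr_eq0; apply/eqP.
    apply: (mulfI ut); apply: (mulfI pa0); apply: (mulfI d).
    rewrite !mulr0; move/eqP: e; rewrite -subr_eq0 => /eqP e; rewrite -[RHS]e.
    by rewrite /Phi /B /C; ring.
  by exists u; split=> //; [apply: second e1 | apply: second e2].
have PhiB a p : Phi a p - Phi a0 p = (a - a0) * B a p by rewrite /Phi /B; ring.
pose BL a : seq F := [:: - (a ^+ 2 + a * a0 + a0 ^+ 2); - (a + a0); 1].
pose CL a : seq F := [:: a0 ^+ 2 + a * a0 - a ^+ 2; a + a0; 1].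
have hornerB a p : (Poly (BL a)).[p] = B a p by rewrite horner_Poly /B /=; ring.
have hornerC a p : (Poly (CL a)).[p] = C a p by rewrite horner_Poly /C /=; ring.
pose P := subL (mulL (BL a1) (CL a2)) (mulL (BL a2) (CL a1)).
pose lin a p : seq F := [:: t * C a p * (p ^+ 2 - a0 ^+ 2); B a p].
pose G p := if B a1 p == 0 then Poly (lin a2 p) else Poly (lin a1 p).
have P0 : Poly P != 0.
  apply/eqP => /(coef_Poly_eq0 3) P3; case/eqP: (mulf_neq0 (two_neq0 S0) a12).
  by rewrite -P3 /=; ring.
rewrite -[20%N]/(1 * 20)%N.
apply: (leq_card_two_roots (G := G) Z_inj P0).
- by apply: leq_trans (size_Poly _) _.
- move=> z /slope[u [ut _ e1 e2]]; apply/rootP.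
  rewrite !Poly_opE hornerD hornerN !hornerM !hornerB !hornerC.
  have [t0|t0] := eqVneq t 0.
    move: ut e1 e2; rewrite t0 oppr0 !mul0r => u0.
    move=> /eqP + /eqP; rewrite !mulf_eq0 (negPf u0) /= => /eqP-> /eqP->.
    by ring.
  apply: (mulfI t0); rewrite mulr0.
  transitivity (- t * C a1 z.1.1 * B a2 z.1.1
                - B a1 z.1.1 * (- t * C a2 z.1.1)); first by ring.
  by rewrite -e1 -e2; ring.
move=> z zZ; have [u [_ er e1 e2]] := slope z zZ.
have Sp := ZS zZ; rewrite er /G.
have lin_root a : u * B a z.1.1 = - t * C a z.1.1 ->
    root (Poly (lin a z.1.1)) (u * (z.1.1 ^+ 2 - a0 ^+ 2)).
  move=> e; apply/rootP; rewrite horner_Poly /=.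
  transitivity ((z.1.1 ^+ 2 - a0 ^+ 2) * (u * B a z.1.1 + t * C a z.1.1)).
    by ring.
  by rewrite e; ring.
have lin_neq0 a : B a z.1.1 != 0 -> Poly (lin a z.1.1) != 0.
  by apply: contra_neq => /(coef_Poly_eq0 1).
have [B1|B1] := eqVneq (B a1 z.1.1) 0; last first.
  by split; [exact: lin_neq0 | exact: size_Poly | exact: lin_root].
split; [apply: lin_neq0 | exact: size_Poly | exact: lin_root].
apply: contra_neq a12 => B2; apply/eqP; rewrite subr_eq0 eq_sym; apply/eqP.
apply: (Phi_diff_eq S0 S1 S2 Sp d1 d2); apply/eqP;
  by rewrite -subr_eq0 PhiB ?B1 ?B2 mulr0.
Qed.

Lemma card_Z_distinct : a1 != a0 -> a2 != a0 -> (#|Z| <= 20)%N.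
Proof.
move=> d1 d2.
have [R0|] := eqVneq (Poly (resL a0 a1 b1 c1 a2 b2 c2)) 0; last first.
  exact: card_Z_generic.
have [|t [e1 e2 e3 e4]] := resL_eq0 (two_neq0 S0) five_neq0 d1 d2 _ R0.
  by apply/eqP => -[ea eb ec]; apply: bc12.
exact: card_Z_line d1 d2 e1 e2 e3 e4.
Qed.

Hypotheses (neq01 : x1 != x0) (neq02 : x2 != x0).

(** When the a_i are equal, the linear equations become
    2 c_i r = c_i^2 + b_i Phi_0: both determine r, and their compatibility is an
    equation of degree at most 3 in p. *)
Lemma card_Z_equal : a1 = a0 -> a2 = a0 -> (#|Z| <= 20)%N.
Proof.
move=> ea1 ea2; have [->|[z0 z0Z]] := set_0Vmem Z; first by rewrite cards0.
have c_neq0 x (b := x.1.2 - x0.1.2) (c := x.2 - x0.2) :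
    x.1.1 = a0 -> x != x0 ->
    (Phi x.1.1 z0.1.1 - Phi a0 z0.1.1) * (z0.1.2 - x0.1.2)
      + 2%:R * c * (z0.2 - x0.2) = c ^+ 2 + b * Phi x.1.1 z0.1.1 -> c != 0.
  move=> ea nx e; apply: contra_neq nx => c0.
  have [_ [f0 _ _] _ _ _] := Z_quadrics z0Z.
  move/esym/eqP: e; rewrite c0 ea subrr !mulr0 !mul0r expr0n !add0r mulf_eq0.
  rewrite (negPf f0) orbF subr_eq0 => /eqP eb.
  move/eqP: c0; rewrite subr_eq0 => /eqP ec.
  move: ea eb ec; rewrite /a0 {b c}; case: x => [[? ?] ?].
  by case: x0 => [[? ?] ?] /= -> -> ->.
have [_ _ _ ez1 ez2] := Z_quadrics z0Z.
have c10 : c1 != 0 by apply: c_neq0 ez1.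
have c20 : c2 != 0 by apply: c_neq0 ez2.
pose Q := subL (scaleL c2 (constL a0 b1 c1)) (scaleL c1 (constL a0 b2 c2)).
have Qp p : (Poly Q).[p] = c2 * (c1 ^+ 2 + b1 * Phi a0 p)
                           - c1 * (c2 ^+ 2 + b2 * Phi a0 p).
  by rewrite !Poly_opE hornerD hornerN !hornerZ !horner_constL.
have Q0 : Poly Q != 0.
  apply/eqP => Q0.
  have ec : c1 = c2.
    apply/eqP; rewrite -subr_eq0; apply/eqP.
    apply: (mulfI c10); apply: (mulfI c20).
    transitivity ((Poly Q).[a0]); first by rewrite Qp /Phi; ring.
    by rewrite Q0 horner0 !mulr0.
  have := coef_Poly_eq0 3 Q0; rewrite /= -ec => /eqP.
  rewrite mulN1r subr_eq0 => /eqP /(mulfI c10) eb.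
  by apply: bc12; rewrite ?ea1 ?ea2.
pose G p : {poly F} := Poly [:: - (c1 ^+ 2 + b1 * Phi a0 p); 2%:R * c1].
rewrite -[20%N]/(1 * 20)%N.
apply: (leq_card_two_roots (G := G) Z_inj Q0).
- by apply: leq_trans (size_Poly _) _.
- move=> z zZ; have [_ _ _] := Z_quadrics zZ.
  rewrite ea1 ea2 subrr !mul0r !add0r => e1 e2.
  by apply/rootP; rewrite Qp -e1 -e2; ring.
move=> z zZ; split.
- apply/eqP => /(coef_Poly_eq0 1)/eqP.
  by rewrite /= mulf_eq0 (negPf c10) (negPf (two_neq0 S0)).
- exact: size_Poly.
have [_ _ _] := Z_quadrics zZ; rewrite ea1 subrr !mul0r !add0r => e1 _.
by apply/rootP; rewrite horner_Poly /= -e1; ring.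
Qed.

End Base.

(** The base point of the elimination has to be one whose first coordinate
    differs from both others; it exists unless all three are equal. *)
Lemma card_common (x : 'I_3 -> F * F * F) (Z : {set F * F * F}) :
    injective x -> (forall i, (x i).1.1 \in S) ->
    {in Z, forall z, z.1.1 \in S} ->
    {in Z, forall z, forall i, z != x i} ->
    {in Z, forall z, exists2 t : 'I_3 -> F,
       injective t & forall i, link (x i) z (t i)} ->
  (#|Z| <= 20)%N.
Proof.
move=> xI xS ZS ZN Zl.
have base i j k : i != j -> i != k -> j != k ->
    (x j).1.1 != (x i).1.1 -> (x k).1.1 != (x i).1.1 -> (#|Z| <= 20)%N.
  move=> ij ik jk; apply: card_Z_distinct; rewrite ?xS ?(inj_eq xI) //.
  - by move=> z zZ; split; apply: ZN.
  - move=> z zZ; have [t tI tl] := Zl z zZ; exists (t i), (t j), (t k).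
    by split; rewrite ?(inj_eq tI).
pose i0 : 'I_3 := inord 0; pose i1 : 'I_3 := inord 1; pose i2 : 'I_3 := inord 2.
have n01 : i0 != i1 by rewrite -val_eqE /= !inordK.
have n02 : i0 != i2 by rewrite -val_eqE /= !inordK.
have n12 : i1 != i2 by rewrite -val_eqE /= !inordK.
have [e1|e1] := eqVneq (x i1).1.1 (x i0).1.1; last first.
  have [e2|e2] := eqVneq (x i2).1.1 (x i0).1.1; last exact: base e1 e2.
  by apply: (base i1 i0 i2) => //; rewrite eq_sym // e2.
have [e2|e2] := eqVneq (x i2).1.1 (x i0).1.1; last first.
  by apply: (base i2 i0 i1) => //; rewrite eq_sym // e1.
apply: (card_Z_equal (x0 := x i0) (x1 := x i1) (x2 := x i2)) => //.
- by rewrite (inj_eq xI).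
- by move=> z zZ; split; apply: ZN.
- move=> z zZ; have [t tI tl] := Zl z zZ; exists (t i0), (t i1), (t i2).
  by split; rewrite ?(inj_eq tI).
- by rewrite (inj_eq xI) eq_sym.
- by rewrite (inj_eq xI) eq_sym.
Qed.

End Counting.

(** * The graph *)

Section Graph.
Variables (F : finFieldType) (S : {set F}).

Definition adj (x y : F * F * F) :=
  [&& x.1.1 \in S, y.1.1 \in S, x.1.2 + y.2 == x.1.1 * y.1.1 ^+ 2,
      x.2 + y.1.2 == x.1.1 ^+ 2 * y.1.1 & x != y].

Lemma adjC x y : adj x y = adj y x.
Proof.
rewrite /adj [y == x]eq_sym [y.1.2 + _]addrC [y.2 + _]addrC.
rewrite [y.1.1 * _]mulrC [y.1.1 ^+ 2 * _]mulrC.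
by apply/and5P/and5P => -[? ? ? ? ?].
Qed.

Definition adj_edges : {set {set F * F * F}} :=
  [set [set u.1; u.2] | u : (F * F * F) * (F * F * F) & adj u.1 u.2].

Lemma adj_edges_card2 : [forall e in adj_edges, #|e| == 2].
Proof.
apply/forall_inP => _ /imsetP[u uA ->]; rewrite inE in uA.
by rewrite cards2; case/and5P: uA => _ _ _ _ ->.
Qed.

Definition adj_graph : sgraph (F * F * F)%type := SGraph adj_edges_card2.

Lemma adj_graphE x y : ([set x; y] \in edges adj_graph) = adj x y.
Proof.
apply/imsetP/idP => [[[u v] /=]|xy]; last by exists (x, y); rewrite ?inE.
rewrite inE => uv e; have uv0 : u != v by case/and5P: uv.
have xy0 : x != y.
  by move: (cards2 x y); rewrite e cards2 uv0; case: (x != y).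
have := set21 x y; have := set22 x y; rewrite e !inE.
case/orP=> /eqP yE /orP[]/eqP xE; move: xy0; rewrite xE yE ?eqxx //.
by rewrite adjC.
Qed.

(** The neighbour of a point [u.1] with first coordinate [u.2]. *)
Definition nbr (u : F * F * F * F) : F * F * F :=
  (u.2, u.1.1.1 ^+ 2 * u.2 - u.1.2, u.1.1.1 * u.2 ^+ 2 - u.1.1.2).

(** Choosing a point and the first coordinate of its neighbour gives
    [#|S| ^ 2 * #|F| ^ 2] ordered pairs; the subtracted term accounts for the
    points that would be adjacent to themselves. *)
Lemma card_adj_edges :
  (#|S| ^ 2 * #|F| ^ 2 - #|S| * #|F| <= 2 * #|edges adj_graph|)%N.
Proof.
pose A := [set u : (F * F * F) * (F * F * F) | adj u.1 u.2].
apply: (@leq_trans #|A|); last first.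
  apply: leq_card_fibers => _ /imsetP[[x y] _ ->] /=.
  apply: (@leq_trans #|[set (x, y); (y, x)]|); last first.
    by rewrite cards2; case: (_ != _).
  apply/subset_leq_card/subsetP => -[u v]; rewrite !inE /= => /andP[uv /eqP e].
  have uv0 : u != v by case/and5P: uv.
  have := set21 u v; have := set22 u v; rewrite e !inE !xpair_eqE.
  by case/orP=> /eqP vE /orP[]/eqP uE; move: uv0; rewrite uE vE !eqxx ?orbT.
pose I := [set u : F * F * F * F | (u.1.1.1 \in S) && (u.2 \in S)].
(* the pairs for which the neighbour is the point itself *)
pose L := [set u : F * F * F * F |
  [&& u.1.1.1 \in S, u.2 == u.1.1.1 & u.1.2 == u.1.1.1 ^+ 3 - u.1.1.2]].
have cI : #|I| = (#|S| ^ 2 * #|F| ^ 2)%N.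
  have -> : I = setX (setX (setX S setT) setT) S.
    by apply/setP => -[[[a b] c] t]; rewrite !inE /= !andbT.
  by rewrite !cardsX !cardsT; ring.
have cL : (#|L| <= #|S| * #|F|)%N.
  rewrite -cardsT -cardsX.
  rewrite -(card_in_imset (f := fun u : F * F * F * F => (u.1.1.1, u.1.1.2))).
    apply/subset_leq_card/subsetP => _ /imsetP[u + ->].
    by rewrite !inE /= andbT => /and3P[].
  move=> [[[a b] c] t] [[[a' b'] c'] t']; rewrite !inE /=.
  by move=> /and3P[_ /eqP-> /eqP->] /and3P[_ /eqP-> /eqP->] [-> ->].
apply: (@leq_trans #|I :\: L|).
  rewrite -cI leq_subLR (leq_trans _ (leq_add cL (leqnn _))) //.
  rewrite -[X in (X <= _)%N](cardsID L I) leq_add2r.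
  by rewrite subset_leq_card // subsetIr.
rewrite -(card_imset (f := fun u : F * F * F * F => (u.1, nbr u))); last first.
  by move=> [u t] [u' t'] [-> ->].
apply/subset_leq_card/subsetP => _ /imsetP[[[[a b] c] t] + ->].
rewrite !inE /adj /nbr /= => /andP[tL /andP[aS tS]].
rewrite aS tS ![_ + (_ - _)]addrC !subrK !eqxx /=.
apply: contra tL => /eqP[at_ _ cE]; rewrite -at_ aS eqxx cE -at_ /=.
by apply/eqP; ring.
Qed.

Lemma adj_link x y z : adj x y -> adj z y -> link x z y.1.1.
Proof.
case/and5P=> _ _ /eqP e1 /eqP e2 _ /and5P[_ _ /eqP f1 /eqP f2 _]; split.
  by rewrite mulrC mulrBl -e1 -f1; ring.
by rewrite mulrC mulrBl -e2 -f2; ring.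
Qed.

Lemma adj_inj x y y' : adj x y -> adj x y' -> y.1.1 = y'.1.1 -> y = y'.
Proof.
case: y y' => [[a b] c] [[a' b'] c'].
case/and5P=> /= _ _ /eqP e1 /eqP e2 _ /and5P[_ _ /eqP /= f1 /eqP f2 _] ea.
by move: e1 e2; rewrite ea -f1 -f2 => /addrI-> /addrI->.
Qed.

Hypothesis S4 : {in S & &, forall a b c, {in S, forall d, a + b + c + d != 0}}.
Hypothesis five_neq0 : 5%:R != 0 :> F.

Lemma adj_graph_Kst_free t :
  (20 < t)%N -> ~~ contains adj_graph (subdivision (Kst 3 t)).
Proof.
move=> t20; apply/negP => /contains_subdivision_Kst[x [y [z]]].
case=> xI zI zx yI xyz.
have xy i j : adj (x i) (y i j) by rewrite -adj_graphE; case: (xyz i j).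
have zy i j : adj (z j) (y i j) by rewrite -adj_graphE; case: (xyz i j).
have t0 : (0 < t)%N by apply: leq_trans t20.
have : (#|[set z j | j : 'I_t]| <= 20)%N.
  apply: (card_common S4 five_neq0 (x := x)) => //.
  - by move=> i; case/and5P: (xy i (Ordinal t0)).
  - by move=> _ /imsetP[j _ ->]; case/and5P: (zy ord0 j).
  - by move=> _ /imsetP[j _ ->] i.
  move=> _ /imsetP[j _ ->]; exists (fun i => (y i j).1.1); last first.
    by move=> i; apply: adj_link.
  by move=> i i' e; apply: (yI j); apply: adj_inj (zy i j) (zy i' j) e.
by rewrite card_imset // card_ord leqNgt t20.
Qed.

End Graph.

(** * Cosets without four elements summing to zero *)

(** Four elements of the coset a + L sum to an element of 4 a + L, which in
    characteristic 3 is a + L again and hence misses 0. *)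
Lemma four_sum_free_coset (F : finFieldType) k :
    #|F| = (3 ^ k.+1)%N -> 3%:R = 0 :> F ->
  exists2 S : {set F}, #|S| = (3 ^ k)%N
    & {in S & &, forall a b c, {in S, forall d, a + b + c + d != 0}}.
Proof.
move=> cF char3.
have p3 : (3.-group [set: F])%g by rewrite /pgroup cardsT cF pnatX pnat_id.
have [|L [_ _ cL]] := @normal_pgroup 3 F k _ _ p3 (normal_refl _).
  by rewrite cardsT cF pfactorK ?leqnSn.
have [a aL] : exists a, a \notin L.
  apply/existsP; rewrite -negb_forall; apply/negP => /forallP allL.
  have : (#|F| <= #|L|)%N.
    by apply: subset_leq_card; apply/subsetP => x _; apply: allL.
  by rewrite cL cF leq_exp2l // ltnn.
exists [set a + x | x in L]; first by rewrite card_imset //; apply: addrI.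
move=> _ _ _ /imsetP[x xL ->] /imsetP[y yL ->] /imsetP[z zL ->].
move=> _ /imsetP[w wL ->].
apply: contraNneq aL => s0.
have -> : a = - (x + y + z + w).
  apply/eqP; rewrite -subr_eq0 opprK -s0; apply/eqP.
  transitivity (a + (x + y + z + w) + 3%:R * a).
    by rewrite char3 mul0r addr0.
  by ring.
have addL u v : u \in L -> v \in L -> u + v \in L by apply: groupM.
have oppL u : u \in L -> - u \in L by apply: groupVr.
by apply/oppL/addL/wL/addL/zL/addL/yL.
Qed.

Lemma exists_char3_field k :
  exists2 F : finFieldType, #|F| = (3 ^ k.+1)%N & 3%:R = 0 :> F.
Proof.
have [F F3 cF] := pPrimePowerField (isT : prime 3) (ltn0Sn k).
by exists F => //; apply: pcharf0.
Qed.

(** * The lower bound *)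

(** With q = 3^(k+1), the graph has q^3 vertices and at least
    (q^4/9 - q^2/3)/2 edges, which is at least q^4/36. *)
Lemma leq_turan_Kst3_subdivision k n t :
  (20 < t)%N -> ((3 ^ k.+1) ^ 3 <= n)%N ->
  ((3 ^ k.+1) ^ 4 <= 36 * turan_number n (subdivision (Kst 3 t)))%N.
Proof.
move=> t20 kn; have [F cF char3] := exists_char3_field k.
have [S cS S4] := four_sum_free_coset cF char3.
have five_neq0 : (5%:R != 0 :> F)%R.
  have -> : (5%:R = 3%:R + 3%:R - 1 :> F)%R by ring.
  by rewrite char3 addr0 sub0r oppr_eq0 oner_eq0.
have cV : (#|{: F * F * F}| <= n)%N.
  rewrite !card_prod cF; apply: leq_trans kn.
  by rewrite [(_ ^ 3)%N]expnSr -mulnn.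
have t0 : (0 < t)%N by apply: leq_trans t20.
have le_e := leq_turan_number cV
  (fun w => subdivision_covered w (isT : (0 < 3)%N) t0)
  (adj_graph_Kst_free S4 five_neq0 t20).
have := card_adj_edges S; rewrite cF cS [(3 ^ k.+1)%N]expnS.
move: #|_| (turan_number _ _) le_e => e T le_e.
have : (0 < 3 ^ k)%N by rewrite expn_gt0.
move: (3 ^ k)%N => q q0 le_pairs.
have : ((3 * q) ^ 4 <= 18 * (q ^ 2 * (3 * q) ^ 2 - q * (3 * q)))%N.
  by rewrite mulnBr leq_subRL; nia.
lia.
Qed.

Theorem theorem1p4 (R : realType) :
  exists (c : R) (n0 : nat), 0 < c /\
    forall n : nat, (n0 <= n)%N ->
      c * (n%:R `^ (4%:R / 3%:R)) <=
        (turan_number n (subdivision (Kst 3 30)))%:R.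
Proof.
(* Let q be the largest power of 3 with q^3 <= n, so that n < (3 q)^3.  Then
   n^(4/3) < 81 q^4, and 2916 = 81 * 36. *)
exists (2916%:R)^-1, 27%N; split; first by rewrite invr_gt0 ltr0n.
move=> n n27; have n0 : (0 < n)%N by apply: leq_trans n27.
pose k := (trunc_log 27 n).-1.
have kE : trunc_log 27 n = k.+1.
  by rewrite prednK // trunc_log_gt0.
have kl : ((3 ^ k.+1) ^ 3 <= n)%N.
  by rewrite -expnM mulnC expnM -[(3 ^ 3)%N]/27%N -kE trunc_logP.
have ku : (n <= (3 ^ k.+2) ^ 3)%N.
  by rewrite -expnM mulnC expnM -[(3 ^ 3)%N]/27%N -kE ltnW // trunc_log_ltn.
have := leq_turan_Kst3_subdivision (isT : (20 < 30)%N) kl.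
set T := turan_number _ _ => le4.
rewrite ler_pdivrMl ?ltr0n //.
apply: (@le_trans _ _ (((3 ^ k.+2) ^ 3)%N%:R `^ (4%:R / 3%:R))).
  by apply: ge0_ler_powR; rewrite ?nnegrE ?divr_ge0 ?ler0n ?ler_nat.
have -> : ((3 ^ k.+2) ^ 3)%N%:R `^ (4%:R / 3%:R) = ((3 ^ k.+2) ^ 4)%N%:R :> R.
  rewrite !natrX -(powR_mulrn 3) ?exprn_ge0 ?ler0n // -powRrM.
  have -> : 3%:R * (4%:R / 3%:R) = 4%:R :> R.
    by rewrite mulrC divfK // pnatr_eq0.
  by rewrite powR_mulrn ?exprn_ge0 ?ler0n.
rewrite -natrM ler_nat.
rewrite [(3 ^ k.+2)%N]expnS expnMn -[(3 ^ 4)%N]/81%N -[2916%N]/(81 * 36)%N.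
by rewrite -mulnA leq_mul2l.
Qed.
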